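(* Let $p_1, p_{er} \ge 0$ with $p_1 + p_{er} \le 1$ be the flip and erasure probabilities of the channel. For each integer $k \ge 1$ let $m = m(k) \ge 1$ be an integer, let a bipartite graph with $k$ message nodes and $m$ parity nodes be given, with message-node neighbourhoods $R_k(1),\ldots,R_k(m) \subseteq \{1,\ldots,k\}$ of the parity nodes, and let a decoder be given, i.e. a function that maps the received word $Y$ to an estimate $\hat{X}$ of the message $X$. Here the message $X$, the codeword and the received word $Y$ are as described in the context. Suppose that the average degree per parity node remains bounded: $$\limsup_{k \to \infty} \frac{1}{m}\sum_{j=1}^{m} \# R_k(j) < \infty .$$ If the decoding error probability $P_k = \mathbb{P}(X \neq \hat{X})$ satisfies $P_k \longrightarrow 0$ as $k \to \infty$, then the encoded rate $R_{enc} = \frac{k}{k+m}$ satisfies $R_{enc} \longrightarrow 0$ as $k \to \infty$.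
   Context: Message: $X = (X_1,\ldots,X_k)$ has independent and identically distributed bits $X_i \in \{0,1\}$ with $\mathbb{P}(X_i = 0) = \mathbb{P}(X_i = 1) = \frac12$. Encoder: there is a bipartite graph with $k$ left nodes (message nodes, indexed by $1,\ldots,k$) and $m = m(k)$ right nodes (parity nodes, indexed by $1,\ldots,m$). For a parity node $j$, $R_k(j) \subseteq \{1,\ldots,k\}$ is the set of message nodes adjacent to $j$, and $\# R_k(j)$ is the degree of $j$. The $j$-th parity bit is $Z_j = \bigoplus_{w \in R_k(j)} X_w$ (addition modulo $2$). The codeword associated with $X$, which is sent through the channel, is $(X_1,\ldots,X_k,Z_1,\ldots,Z_m)$. The encoded rate is $R_{enc} = \frac{k}{k+m}$. Channel: each transmitted bit is independently retained, flipped or erased. The noise alphabet is $\{\alpha_0,\alpha_1,\alpha_{er}\}$ (three distinct symbols), and $\alpha_{er}$ also serves as the erasure symbol, different from $0$ and $1$. The noise variables $N_x(1),\ldots,N_x(k),N_z(1),\ldots,N_z(m)$ are i.i.d., are independent of the transmitted bits, and each takes the value $\alpha_{er}$ with probability $p_{er}$, the value $\alpha_1$ with probability $p_1$, and the value $\alpha_0$ with probability $1-p_1-p_{er}$, where $p_1,p_{er}$ do not depend on $k$. The received message symbol $\tilde{X}_i$ equals $\alpha_{er}$ if $N_x(i) = \alpha_{er}$, equals $X_i$ if $N_x(i) = \alpha_0$, and equals $1-X_i$ if $N_x(i) = \alpha_1$. The received parity symbol $\tilde{Z}_j$ equals $\alpha_{er}$ if $N_z(j) = \alpha_{er}$, equals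 $Z_j$ if $N_z(j) = \alpha_0$, and equals $1-Z_j$ if $N_z(j) = \alpha_1$. The received word is $Y = (\tilde{X}_1,\ldots,\tilde{X}_k,\tilde{Z}_1,\ldots,\tilde{Z}_m)$.
   Formalization: The formal theorem additionally assumes that if the erasure probability is 0 then 0 < p_1 < 1; the claim is false for the two excluded channels (p_1, p_er) = (0,0) and (1,0), where uncoded bits are decoded without error at rate k/(k+1). *)

(* Defs.v *)
From HB Require Import structures.
From mathcomp Require Import all_boot all_order all_algebra.
From mathcomp Require Import all_classical all_reals all_analysis.

Set Implicit Arguments.
Unset Strict Implicit.
Unset Printing Implicit Defensive.

Import Order.TTheory GRing.Theory Num.Theory.
Import numFieldNormedType.Exports.

Local Open Scope classical_set_scope.
Local Open Scope ring_scope.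

(* Noise alphabet.  It is encoded in [option bool] because its symbol
   [alpha_er = None] is also the erasure symbol of the received alphabet
   [option bool], in which [Some b] is the unerased bit [b]. *)
Definition noise : Type := option bool.
HB.instance Definition _ := Finite.on noise.
HB.instance Definition _ := isPointed.Build noise None.
HB.instance Definition _ := @isMeasurable.Build default_measure_display
  noise discrete_measurable discrete_measurable0
  discrete_measurableC discrete_measurableU.

Definition alpha_er : noise := None.
Definition alpha_0 : noise := Some false.
Definition alpha_1 : noise := Some true.

(* A bipartite graph with k left and m right nodes is given by the
   neighbourhoods [nb j] of its right nodes.  Codewords and received words
   are indexed by ['I_k + 'I_m]: [inl i] is the i-th message position, [inr j]
   the j-th parity position. *)
Definition codeword (k m : nat) (nb : 'I_m -> {set 'I_k})
    (x : {ffun 'I_k -> bool}) : {ffun 'I_k + 'I_m -> bool} :=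
  [ffun s => match s with
             | inl i => x i
             | inr j => \big[addb/false]_(w in nb j) x w
             end].

Definition channel (b : bool) (n : noise) : option bool :=
  if n == alpha_er then None
  else if n == alpha_0 then Some b else Some (~~ b).

Definition received (I : finType) (c : {ffun I -> bool}) (n : {ffun I -> noise})
    : {ffun I -> option bool} :=
  [ffun s => channel (c s) (n s)].

Definition random_vector (T A : Type) (I : finType) (V : I -> T -> A)
    : T -> {ffun I -> A} :=
  fun t => [ffun i => V i t].

Definition mutually_independent (d d' : measure_display)
    (T : measurableType d) (A : measurableType d') (R : realType)
    (P : probability T R) (I : finType) (V : I -> {RV P >-> A}) : Prop :=
  forall (J : {set I}) (B : I -> set A),
    (forall i, i \in J -> measurable (B i)) ->
    P (\bigcap_(i in [set` J]) (V i @^-1` B i)) =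
    (\prod_(i in J) P (V i @^-1` B i))%E.

(* For finite S1 and S2, every subset of which is measurable. *)
Definition independent_pair (d : measure_display) (T : measurableType d)
    (R : realType) (P : probability T R) (S1 S2 : finType)
    (U : T -> S1) (V : T -> S2) : Prop :=
  forall (A : set S1) (B : set S2),
    P (U @^-1` A `&` V @^-1` B) = (P (U @^-1` A) * P (V @^-1` B))%E.

Definition uniform_message (d : measure_display) (T : measurableType d)
    (R : realType) (P : probability T R) (k : nat)
    (X : 'I_k -> {RV P >-> bool}) : Prop :=
  mutually_independent X /\
  forall i b, distribution P (X i) [set b] = (2^-1 : R)%:E.

Definition iid_noise (d : measure_display) (T : measurableType d)
    (R : realType) (P : probability T R) (p1 per : R) (I : finType)
    (N : I -> {RV P >-> noise}) : Prop :=
  mutually_independent N /\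
  forall s, [/\ distribution P (N s) [set alpha_er] = per%:E,
                distribution P (N s) [set alpha_1] = p1%:E &
                distribution P (N s) [set alpha_0] = (1 - p1 - per)%:E].

Definition avg_degree (R : realType) (k m : nat) (nb : 'I_m -> {set 'I_k}) : R :=
  m%:R^-1 * \sum_(j < m) #|nb j|%:R.

Definition decoding_error (T : Type) (k m : nat) (nb : 'I_m -> {set 'I_k})
    (dec : {ffun 'I_k + 'I_m -> option bool} -> {ffun 'I_k -> bool})
    (X : 'I_k -> T -> bool) (N : 'I_k + 'I_m -> T -> noise) : set T :=
  [set t | random_vector X t <>
           dec (received (codeword nb (random_vector X t)) (random_vector N t))].

Definition encoded_rate (R : realType) (k m : nat) : R := k%:R / (k + m)%:R.

(* Main.v *)
Require Import Defs.
From mathcomp Require Import all_boot all_order all_algebra.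
From mathcomp Require Import all_classical all_reals all_analysis.

Import Order.TTheory GRing.Theory Num.Theory.
Import numFieldNormedType.Exports.

Local Open Scope classical_set_scope.
Local Open Scope ring_scope.

(** A code with few parity bits per message bit and bounded average parity
degree has a message node i of bounded degree, because the k message degrees
add up to the same number of edges as the m parity degrees
([exists_low_degree]).  Flipping the bit X_i changes only 1 + deg(i) of the
transmitted symbols ([codeword_flip_bit]), and the channel is noisy enough to
hide these changes from any decoder with a probability that depends on deg(i)
only.

The last claim is a two-point (Le Cam) argument.  Write W(y|c) for the
probability of receiving y when the word c is sent.  If c and c' encode two
different messages, then the decoder is wrong about at least one of them at
each y, so that the two error probabilities add up to at least the sum over y
of min(W(y|c), W(y|c')).  As the channel is memoryless, this is at least the
sum over y of the product over the positions s of min(W(y_s|c_s), W(y_s|c'_s)),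
which factors over the positions: a position where c and c' agree contributes
1, and a position where they differ contributes the overlap of the output laws
of the bits 0 and 1, namely
   eta = per + 2 min(1 - p1 - per, p1).
Averaging over the uniform message, paired with its flip at i, gives
   P_k >= eta^(1 + deg(i)) / 2
([error_lower_bound]).  The hypothesis on the noise says precisely that
eta > 0.  If the rate exceeds e > 0 then m <= k / e, and if the average parity
degree is at most D then deg(i) <= m D / k <= D / e for some i.  Hence P_k is
bounded below by a positive constant for such k, which contradicts P_k --> 0
once k is large. *)

(** * Overlap of the output laws of the channel *)

(** For a fixed input, the channel is a bijection from noise to output, and with
the common encoding of both alphabets it is its own inverse.  Hence the
probability of the output y on the input b is the mass of the noise symbol
[channel b y]; all transition probabilities below are written in this form. *)
Lemma channelK (b : bool) : involutive (channel b).
Proof. by case: b => -[[]|]. Qed.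

Lemma receivedK (I : finType) (c : {ffun I -> bool}) : involutive (received c).
Proof. by move=> n; apply/ffunP => s; rewrite !ffunE channelK. Qed.

Lemma sum_noise {V : nmodType} (f : noise -> V) :
  \sum_n f n = f alpha_er + (f alpha_0 + f alpha_1).
Proof.
rewrite (bigD1 alpha_er) // (bigD1 alpha_0) // (bigD1 alpha_1) //=.
by rewrite big1 ?addr0 // => -[[]|].
Qed.

(** One minus the total variation distance between the output laws of the two
input bits, when the noise has law [mu]. *)
Definition overlap {R : realDomainType} (mu : noise -> R) : R :=
  \sum_(y : noise) Num.min (mu (channel false y)) (mu (channel true y)).

Lemma overlapE {R : realDomainType} (mu : noise -> R) :
  overlap mu = mu alpha_er + Num.min (mu alpha_0) (mu alpha_1) *+ 2.
Proof.
by rewrite /overlap sum_noise /= minxx mulr2n [Num.min (mu alpha_1) _]minC.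
Qed.

(** The overlap of the output laws of two words tensorizes: the sum over
received words of a product over positions is the product of the one-position
sums, and the sum at a position where the words agree is the total mass 1. *)
Lemma sum_min_word_law {R : realDomainType} (mu : noise -> R) (I : finType)
    (c c' : {ffun I -> bool}) :
  \sum_n mu n = 1 ->
  \sum_(y : {ffun I -> noise})
     \prod_s Num.min (mu (channel (c s) (y s))) (mu (channel (c' s) (y s))) =
  overlap mu ^+ #|[pred s | c s != c' s]|.
Proof.
move=> mu1.
rewrite -(bigA_distr_bigA (fun s (a : noise) =>
  Num.min (mu (channel (c s) a)) (mu (channel (c' s) a)))) /=.
rewrite -prodr_const (bigID (fun s => c s != c' s)) /=.
rewrite [X in _ * X]big1 ?mulr1 => [|s]; last first.
  rewrite negbK => /eqP <-; rewrite -mu1.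
  under eq_bigr do rewrite minxx.
  by rewrite [RHS](reindex_inj (inv_inj (channelK (c s)))).
apply: eq_big => [s|s]; first by rewrite inE.
rewrite /overlap.
by case: (c s); case: (c' s) => //= _; apply: eq_bigr => y _; rewrite minC.
Qed.

Lemma prod_min_le {R : realDomainType} (I : finType) (f g : I -> R) :
  (forall i, 0 <= f i) -> (forall i, 0 <= g i) ->
  \prod_i Num.min (f i) (g i) <= Num.min (\prod_i f i) (\prod_i g i).
Proof.
move=> f0 g0; rewrite le_min !ler_prod// => i _;
by rewrite le_min f0 g0/= ge_min lexx ?orbT.
Qed.

(** The two-point argument, averaged over a whole code.  The self-map [f] pairs
each message with another one whose codeword lies at Hamming distance [h];
counting the error of each message once for itself and once as an [f]-image
accounts for the factor 2. *)
Lemma confusable_error {R : realDomainType} (mu : noise -> R) (M I : finType)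
    (C : M -> {ffun I -> bool}) (dec : {ffun I -> option bool} -> M)
    (f : M -> M) (h : nat) :
  (forall n, 0 <= mu n) -> \sum_n mu n = 1 ->
  injective f -> (forall x, f x != x) ->
  (forall x, #|[pred s | C x s != C (f x) s]| = h) ->
  #|M|%:R * overlap mu ^+ h <=
  (\sum_x \sum_(n | dec (received (C x) n) != x) \prod_s mu (n s)) *+ 2.
Proof.
move=> mu0 mu1 finj fx Ch.
pose W x (y : {ffun I -> noise}) := \prod_s mu (channel (C x s) (y s)).
have W0 x y : 0 <= W x y by apply: prodr_ge0.
(* Sum over received words instead of noise vectors. *)
have -> : \sum_x \sum_(n | dec (received (C x) n) != x) \prod_s mu (n s) =
    \sum_x \sum_(y | dec y != x) W x y.
  apply: eq_bigr => x _; rewrite (reindex_inj (inv_inj (receivedK _ (C x)))) /=.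
  apply: eq_big => [y|y _]; first by rewrite receivedK.
  by apply: eq_bigr => s _; rewrite ffunE.
(* The second copy of the total error is summed over the messages f x. *)
rewrite mulr2n {2}(reindex_inj finj) -big_split /=.
rewrite mulr_natl -sumr_const; apply: ler_sum => x _.
rewrite -(Ch x) -sum_min_word_law// 2!(big_mkcond (fun y => dec y != _)).
rewrite -big_split /=; apply: ler_sum => y _.
have := prod_min_le _ (fun s => mu (channel (C x s) (y s)))
  (fun s => mu (channel (C (f x) s) (y s))) (fun=> mu0 _) (fun=> mu0 _).
rewrite le_min -/(W x y) -/(W (f x) y) => /andP[Wx Wfx].
(* If y is decoded as x, then it is an error for f x, otherwise for x. *)
have [yx|_] := eqVneq (dec y) x; last first.
  by apply: (le_trans Wx); rewrite lerDl; case: ifP.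
by rewrite yx eq_sym fx add0r.
Qed.

(** * Flipping one message bit *)

Definition flip_bit {k : nat} (i : 'I_k) (x : {ffun 'I_k -> bool}) :
  {ffun 'I_k -> bool} := [ffun w => x w (+) (w == i)].

Lemma flip_bitK (k : nat) (i : 'I_k) : involutive (flip_bit i).
Proof. by move=> x; apply/ffunP => w; rewrite !ffunE addbK. Qed.

Lemma flip_bit_neq (k : nat) (i : 'I_k) x : flip_bit i x != x.
Proof. by apply/eqP => /ffunP/(_ i); rewrite ffunE eqxx; case: (x i). Qed.

Definition degree {k m : nat} (nb : 'I_m -> {set 'I_k}) (i : 'I_k) : nat :=
  \sum_(j < m) (i \in nb j).

(** The changed positions are the message position i itself and, by linearity of
the parities, the parity nodes adjacent to i. *)
Lemma codeword_flip_bit (k m : nat) (nb : 'I_m -> {set 'I_k}) (i : 'I_k) x :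
  #|[pred s | codeword nb x s != codeword nb (flip_bit i x) s]| =
  (degree nb i).+1.
Proof.
have neq_addb (a b : bool) : (a != a (+) b) = b by case: a; case: b.
rewrite -sum1_card big_mkcond big_sumType /=.
rewrite (bigD1 i) //= inE !ffunE eqxx neq_addb big1 ?addn0 => [|w /negPf wi].
  rewrite add1n; congr _.+1; apply: eq_bigr => j _; rewrite inE !ffunE.
  under [X in _ != X]eq_bigr do rewrite ffunE.
  rewrite big_split /= neq_addb.
  case: (boolP (i \in nb j)) => ij.
    rewrite (bigD1 i) //= eqxx big1 // => w /andP[_ /negPf//].
  by rewrite big1 // => w wj; apply: contraNF ij => /eqP <-.
by rewrite inE !ffunE wi neq_addb.
Qed.

Lemma sum_degree (k m : nat) (nb : 'I_m -> {set 'I_k}) :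
  (\sum_i degree nb i = \sum_j #|nb j|)%N.
Proof.
rewrite exchange_big /=; apply: eq_bigr => j _.
by rewrite -sum1_card [RHS]big_mkcond.
Qed.

(** The minimum message degree is at most the average one, here freed of the
division by k. *)
Lemma exists_low_degree (k m : nat) (nb : 'I_m -> {set 'I_k}) :
  (0 < k)%N -> exists i, (k * degree nb i <= \sum_j #|nb j|)%N.
Proof.
case: k nb => // k nb _.
exists [arg min_(i < ord0) degree nb i].
case: arg_minnP => // i _ imin; rewrite -sum_degree.
by rewrite -{1}(card_ord k.+1) -sum_nat_const leq_sum.
Qed.

(** * The law of the message and of the noise *)

Lemma probability_finite_image {d} {T : measurableType d} {R : realType}
    (P : probability T R) (A : finType) (V : T -> A) (Q : pred A) :
  (forall a, measurable (V @^-1` [set a])) ->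
  P (V @^-1` [set a | Q a]) = (\sum_(a | Q a) P (V @^-1` [set a]))%E.
Proof.
move=> mV.
have -> : V @^-1` [set a | Q a] = \bigcup_(a in [set a | Q a]) V @^-1` [set a].
  apply/seteqP; split => [t Qt|t [a Qa /= Va]]; first by exists (V t).
  by rewrite /= Va.
rewrite measure_fin_bigcup //; first last.
- by move=> a b _ _ [t [<- <-]].
- exact: finite_finset.
rewrite -(@bigfs _ _ _ _ (index_enum A) Q) ?index_enum_uniq // => a _.
by rewrite mem_index_enum.
Qed.

Lemma random_vector_atom {T A : Type} (I : finType) (V : I -> T -> A) v :
  random_vector V @^-1` [set v] =
  \bigcap_(i in [set` [set: I]%SET]) (V i @^-1` [set v i]).
Proof.
apply/seteqP; split => [t <- i _|t Vt]; first by rewrite /= ffunE.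
by apply/ffunP => i; rewrite ffunE; apply: Vt => /=; rewrite inE.
Qed.

Lemma measurable_random_vector {d d'} {T : measurableType d}
    {A : measurableType d'} {R : realType} (P : probability T R) (I : finType)
    (V : I -> {RV P >-> A}) v :
  (forall a : A, measurable [set a]) ->
  measurable (random_vector V @^-1` [set v]).
Proof.
move=> mA; rewrite random_vector_atom; apply: fin_bigcap_measurable => // i _.
exact: measurable_funPTI.
Qed.

Lemma independent_vector_law {d d'} {T : measurableType d}
    {A : measurableType d'} {R : realType} (P : probability T R) (I : finType)
    (V : I -> {RV P >-> A}) v :
  (forall a : A, measurable [set a]) -> mutually_independent V ->
  P (random_vector V @^-1` [set v]) =
  (\prod_i distribution P (V i) [set v i])%E.
Proof.
move=> mA indV; rewrite random_vector_atom indV //.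
by apply: eq_bigl => i; rewrite inE.
Qed.

(** * The error probability of a single code *)

Definition noise_mass {R : realDomainType} (p1 per : R) (n : noise) : R :=
  if n is Some b then if b then p1 else 1 - p1 - per else per.

(** The joint law of message and noise is a product because the codeword, which
is independent of the noise, determines the message. *)
Lemma error_probabilityE {d} {T : measurableType d} {R : realType}
    (P : probability T R) (p1 per : R) (k m : nat) (nb : 'I_m -> {set 'I_k})
    (dec : {ffun 'I_k + 'I_m -> option bool} -> {ffun 'I_k -> bool})
    (X : 'I_k -> {RV P >-> bool}) (N : 'I_k + 'I_m -> {RV P >-> noise}) :
  uniform_message X -> iid_noise p1 per N ->
  independent_pair P (fun t => codeword nb (random_vector X t))
    (random_vector N) ->
  P (decoding_error nb dec X N) =
  ((2^-1) ^+ k * \sum_x \sum_(n | dec (received (codeword nb x) n) != x)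
     \prod_s noise_mass p1 per (n s))%:E.
Proof.
move=> [indX lawX] [indN lawN] indXN.
pose V t := (random_vector X t, random_vector N t).
have mb (b : bool) : measurable [set b] by [].
have mn (n : noise) : measurable [set n] by [].
have VE a : V @^-1` [set a] =
    random_vector X @^-1` [set a.1] `&` random_vector N @^-1` [set a.2].
  case: a => x n; apply/seteqP; split => [t [<- <-]//|t [/= Xt Nt]].
  by rewrite /V /= Xt Nt.
have codeword_inj : injective (codeword nb).
  by move=> x x' /ffunP e; apply/ffunP => i; have := e (inl i); rewrite !ffunE.
have PV x n : P (V @^-1` [set (x, n)]) =
    ((2^-1) ^+ k * \prod_s noise_mass p1 per (n s))%:E.
  (* Pass to the codeword for the independence, and back for the law of X. *)
  rewrite VE /=.
  have -> : random_vector X @^-1` [set x] =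
      (fun t => codeword nb (random_vector X t)) @^-1` [set codeword nb x].
    by apply/seteqP; split => [t <-//|t /codeword_inj].
  rewrite indXN.
  have -> : (fun t => codeword nb (random_vector X t)) @^-1` [set codeword nb x]
      = random_vector X @^-1` [set x].
    by apply/seteqP; split => [t /codeword_inj//|t <-].
  rewrite !independent_vector_law // EFinM -prodEFin; congr (_ * _)%E.
    under eq_bigr do rewrite lawX.
    by rewrite prodEFin prodr_const card_ord.
  apply: eq_bigr => s _; have [Ler L1 L0] := lawN s.
  by case: (n s) => [[]|].
have -> : decoding_error nb dec X N =
    V @^-1` [set a | dec (received (codeword nb a.1) a.2) != a.1].
  apply/seteqP; split => [t /eqP|t /= /eqP] err; last exact/nesym.
  by rewrite /= eq_sym.
rewrite probability_finite_image => [|a]; last first.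
  by rewrite VE; apply: measurableI; exact: measurable_random_vector.
rewrite mulr_sumr -sumEFin.
under [RHS]eq_bigr do rewrite mulr_sumr -sumEFin.
rewrite (pair_big_dep xpredT
  (fun x n => dec (received (codeword nb x) n) != x)) /=.
by apply: eq_bigr => -[x n] _; rewrite PV.
Qed.

(** The error bound for confusable messages, with each message paired with its
flip at i; the number 2^k of messages cancels the weight 2^-k of each. *)
Lemma error_lower_bound {d} {T : measurableType d} {R : realType}
    (P : probability T R) (p1 per : R) (k m : nat) (nb : 'I_m -> {set 'I_k})
    (dec : {ffun 'I_k + 'I_m -> option bool} -> {ffun 'I_k -> bool})
    (X : 'I_k -> {RV P >-> bool}) (N : 'I_k + 'I_m -> {RV P >-> noise}) i :
  0 <= p1 -> 0 <= per -> p1 + per <= 1 ->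
  uniform_message X -> iid_noise p1 per N ->
  independent_pair P (fun t => codeword nb (random_vector X t))
    (random_vector N) ->
  ((2^-1 * overlap (noise_mass p1 per) ^+ (degree nb i).+1)%:E <=
   P (decoding_error nb dec X N))%E.
Proof.
move=> p1_ge0 per_ge0 p_le1 unifX iidN indXN.
rewrite (error_probabilityE _ p1 per) // lee_fin.
have mu0 n : 0 <= noise_mass p1 per n.
  by case: n => [[]|] //=; rewrite -addrA -opprD subr_ge0.
have mu1 : \sum_n noise_mass p1 per n = 1.
  by rewrite sum_noise /= [in X in _ + X]addrAC subrK subrKC.
have := @confusable_error _ _ _ _ (codeword nb) dec (flip_bit i) _ mu0 mu1
  (inv_inj (flip_bitK _ i)) (flip_bit_neq _ i) (codeword_flip_bit _ _ nb i).
rewrite card_ffun card_bool card_ord natrX.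
rewrite exprVn ler_pdivlMl ?exprn_gt0 // mulrCA ler_pdivrMl // mulr_natl.
exact.
Qed.

(** If nothing is ever erased, then both the retained and the flipped bits must
occur with positive probability for the two inputs to be confusable. *)
Lemma overlap_noise_mass_gt0 {R : realDomainType} (p1 per : R) :
  0 <= p1 -> 0 <= per -> p1 + per <= 1 -> (per = 0 -> 0 < p1 < 1) ->
  0 < overlap (noise_mass p1 per).
Proof.
move=> p1_ge0 per_ge0 p_le1 noisy; rewrite overlapE /=.
have p0_ge0 : 0 <= 1 - p1 - per by rewrite -addrA -opprD subr_ge0.
have [per0|per_neq0] := eqVneq per 0.
  have /andP[p1_gt0 p1_lt1] := noisy per0.
  by rewrite per0 add0r subr0 mulr2n addr_gt0 // lt_min subr_gt0 p1_lt1 p1_gt0.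
rewrite ltr_wpDr ?lt_def ?per_neq0 //.
by rewrite mulrn_wge0 // le_min p0_ge0.
Qed.

Lemma overlap_noise_mass_le1 {R : realDomainType} (p1 per : R) :
  overlap (noise_mass p1 per) <= 1.
Proof.
rewrite overlapE /= mulr2n -lerBrDl.
have -> : 1 - per = (1 - p1 - per) + p1 by rewrite addrAC subrK.
by apply: lerD; rewrite ge_min lexx ?orbT.
Qed.

(** * Long codes *)

Lemma limn_esup_lty_bounded {R : realType} (u : nat -> R) :
  (limn_esup (fun k => (u k)%:E) < +oo)%E ->
  exists2 D, 0 <= D & \forall k \near \oo, u k <= D.
Proof.
move=> /ereal_inf_lt[_ [A Aoo <-] supA].
have [D leD] : exists D : R, (ereal_sup [set (u k)%:E | k in A] <= D%:E)%E.
  by case: ereal_sup supA => [D _|//|_]; [exists D|exists 0; rewrite leNye].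
exists (Num.max 0 D); first by rewrite le_max lexx.
apply: filterS Aoo => k Ak.
rewrite le_max -[u k <= D]lee_fin (le_trans _ leD) ?orbT //.
by apply: ereal_sup_ubound; exists k.
Qed.

Theorem theorem1 (R : realType) (p1 per : R)
  (p1_ge0 : 0 <= p1) (per_ge0 : 0 <= per) (p1_per_le1 : p1 + per <= 1)
  (noisy : per = 0 -> 0 < p1 < 1)
  (m : nat -> nat) (m_gt0 : forall k, (0 < k)%N -> (0 < m k)%N)
  (nb : forall k, 'I_(m k) -> {set 'I_k})
  (dec : forall k, {ffun 'I_k + 'I_(m k) -> option bool} -> {ffun 'I_k -> bool})
  (d : nat -> measure_display) (T : forall k, measurableType (d k))
  (P : forall k, probability (T k) R)
  (X : forall k, 'I_k -> {RV (P k) >-> bool})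
  (N : forall k, 'I_k + 'I_(m k) -> {RV (P k) >-> noise})
  (message : forall k, (0 < k)%N -> uniform_message (X k))
  (noise_law : forall k, (0 < k)%N -> iid_noise p1 per (N k))
  (noise_indep : forall k, (0 < k)%N ->
     independent_pair (P k)
       (fun t => codeword (nb k) (random_vector (X k) t))
       (random_vector (N k)))
  (degree_bounded :
     (limn_esup (fun k => (avg_degree R (nb k))%:E) < +oo)%E)
  (error_cvg0 :
     (fun k => P k (decoding_error (nb k) (dec k) (X k) (N k))) @ \oo --> 0%E) :
  (fun k => encoded_rate R k (m k)) @ \oo --> (0 : R).
Proof.
have [D D_ge0 avg_le] := limn_esup_lty_bounded _ degree_bounded.
have ov_gt0 := overlap_noise_mass_gt0 _ _ p1_ge0 per_ge0 p1_per_le1 noisy.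
have ov_le1 := overlap_noise_mass_le1 p1 per.
set ov := overlap _ in ov_gt0 ov_le1.
apply/cvgr0Pnorm_le => e e_gt0.
(* L bounds the least message degree of a code of rate larger than e. *)
pose L := Num.Def.archi_bound (D / e).
have DeL : D / e < L%:R by apply: archi_boundP; rewrite divr_ge0 // ltW.
have delta_gt0 : 0 < 2^-1 * ov ^+ L.+1 by rewrite mulr_gt0 ?invr_gt0 ?exprn_gt0.
have [err_fin err_cvg] := (fine_cvgP _ _).1 error_cvg0.
have err_lt := cvgr0_norm_lt _ err_cvg _ delta_gt0.
near=> k.
have k_gt0 : (0 < k)%N by near: k; exists 1%N.
have kR_gt0 : 0 < k%:R :> R by rewrite ltr0n.
have mR_gt0 : 0 < (m k)%:R :> R by rewrite ltr0n m_gt0.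
rewrite ger0_norm ?divr_ge0 // leNgt; apply/negP => rate_gt.
have em_lt : e * (m k)%:R <= k%:R.
  move: rate_gt; rewrite /encoded_rate ltr_pdivlMr ?ltr0n ?addn_gt0 ?k_gt0 //.
  by move/ltW; apply: le_trans; rewrite ler_pM2l // ler_nat leq_addl.
have [i low_i] := exists_low_degree _ _ (nb k) k_gt0.
have deg_le : (degree (nb k) i <= L)%N.
  rewrite -(ler_nat R) (le_trans _ (ltW DeL)) // ler_pdivlMr //.
  rewrite -(ler_pM2l kR_gt0) mulrA -natrM.
  apply: (@le_trans _ _ ((m k)%:R * D * e)); last first.
    by rewrite mulrAC ler_wpM2r // [_ * e]mulrC.
  rewrite ler_pM2r // (le_trans (_ : _ <= (\sum_j #|nb k j|)%:R)) ?ler_nat //.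
  rewrite natr_sum -ler_pdivrMl //; near: k; exact: avg_le.
have := error_lower_bound (P k) p1 per _ _ (nb k) (dec k) (X k) (N k) i
  p1_ge0 per_ge0 p1_per_le1 (message k k_gt0) (noise_law k k_gt0)
  (noise_indep k k_gt0).
rewrite -[X in (_ <= X)%E]fineK; last by near: k; exact: err_fin.
rewrite lee_fin leNgt -/ov => /negP; apply.
apply: (@lt_le_trans _ _ (2^-1 * ov ^+ L.+1)).
  by apply: le_lt_trans (ler_norm _) _; near: k; exact: err_lt.
by rewrite ler_pM2l ?invr_gt0 // ler_wiXn2l // ltW.
Unshelve. all: by end_near.
Qed.
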